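(* The independence models generated by separation ($\perp$) in graphs with four types of edges are identical to the independence models associated with the following subclasses of graphs in the literature. That is, for a graph $G=(V,E)$ and all pairwise disjoint $A,B,C\subseteq V$: (1) if $G$ is a summary graph (in particular an ancestral graph, an acyclic directed mixed graph, a bidirected chain graph with the multivariate regression Markov property, a regression graph, an undirected graph, a bidirected graph or a directed acyclic graph), then $A\perp B\,|\,C$ if and only if $A$ and $B$ are $m$-separated by $C$; (2) if $G$ is a chain mixed graph (in particular an anterial graph, or an undirected chain graph with the LWF Markov property), then $A\perp B\,|\,C$ if and only if $A$ and $B$ are $c$-separated by $C$; (3) if $G$ is a marginal AMP graph (in particular a dotted line chain graph with the AMP Markov property, or a dotted line graph), then $A\perp B\,|\,C$ if and only if $A$ and $B$ are $z$-separated by $C$; (4) if $G$ is an alternative acyclic directed mixed graph, then $A\perp B\,|\,C$ if and only if $A$ and $B$ are separated by $C$ according to the route criterion.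
   Context: Graphs: a graph $G=(V,E)$ has a finite node set $V$ and edges of four possible types: lines (solid, undirected), arrows ($i\to j$), arcs ($i\leftrightarrow j$), and dotted lines (undirected, written $i\cdots j$). There are no loops, but multiple edges between the same two nodes are allowed. A walk (route) is a list $\langle i_0,e_1,i_1,\dots,e_n,i_n\rangle$ of nodes and edges with $e_m$ having endpoints $i_{m-1},i_m$; nodes and edges may repeat. A path is a walk with no repeated node. A cycle is a closed walk with at least two edges and no repeated node except its coinciding first and last nodes. $\mathrm{pa}(k)$ is the set of $l$ with $l\to k$, and $\mathrm{sp}(k)$ is the set of $l$ with $l\leftrightarrow k$. Separation $\perp$: a section of a walk is a maximal subwalk consisting only of solid lines (possibly a single node). A section is an endpoint section if it contains an endpoint of the walk, otherwise an inner section. An inner section is a collider section if, of the two edges of the walk adjacent to it, both have an arrowhead pointing to the section, or one has an arrowhead pointing to the section and the other is a dotted line. All other sections, including endpoint sections, are non-collider. A walk is connecting given $C$ if all its collider sections intersect $C$ and all its non-collider sections are disjoint from $C$. $A\perp B\,|\,C$ means that there is no connecting walk given $C$ between $A$ and $B$. A node on a path is called a collider (non-collider) node if it is an inner node which, with its two adjacent edges on the path, satisfies (respectively, does not satisfy) the collider condition (both edges have an arrowhead at the node, or one has an arrowhead at it and the other is a dotted line); endpoints are non-colliders. Ancestors and anteriors: $\mathrm{An}(C)$ is $C$ together with all nodes having a directed walk (all arrows pointing forward) to a node of $C$. A walk from $i$ to $j$ is semi-directed if it has at least one arrow, no arcs, and every arrow points in the direction from $i$ to $j$; in graphs without dotted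 lines it is anterior if it is semi-directed or consists only of lines. Classes of graphs. Chain mixed graph (CMG): no dotted lines and no semi-directed cycles. Summary graph: a CMG with no arrowhead pointing to a node that is an endpoint of a line. Ancestral graph: a summary graph in which no arc has one endpoint that is an ancestor of the other. Acyclic directed mixed graph (ADMG): a summary graph without lines. Anterial graph: a CMG in which no arc has one endpoint that is an anterior of the other. Undirected graph, bidirected graph, dotted line graph: only lines, only arcs, only dotted lines, respectively. Directed acyclic graph (DAG): only arrows, with no directed cycle. Chain graph: after removing all arrows, each connected component (chain component) contains only one type of edge, and replacing every chain component by a node yields a DAG; it is an undirected, bidirected or dotted line chain graph if all chain components contain lines, arcs, or dotted lines, respectively. Regression graph: a chain graph with lines, arcs and arrows having no arrowhead pointing to an endpoint of a line. Marginal AMP graph (MAMP): a graph without lines such that (i) there is no closed walk $\langle i=i_0,i_1,\dots,i_n=i\rangle$ containing at least one arrow in which every arrow between $i_q$ and $i_{q+1}$ points from $i_q$ to $i_{q+1}$; (ii) there is no cycle composed of dotted lines and one arc; (iii) if $i\cdots j\cdots k$ and $j\leftrightarrow l$ for some $l$, then $i\cdots k$. Alternative ADMG: a graph obtained from an ADMG by replacing its arcs by dotted lines (so it contains only arrows and dotted lines and has no directed cycles). Associated criteria from the literature (in the present edge notation). $m$-separation: a path is $m$-connecting given $C$ if all its collider nodes are in $\mathrm{An}(C)$ and all its non-collider nodes are outside $C$; $A,B$ are $m$-separated by $C$ if there is no $m$-connecting path given $C$ between them. $c$-separation: in a graph without dotted lines, a walk is $c$-connecting given $C$ if every section at which two arrowheads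 meet intersects $C$ and every other section is disjoint from $C$; $A,B$ are $c$-separated by $C$ if there is no $c$-connecting walk given $C$ between them. $z$-separation: a path $\pi$ is $z$-connecting given $C$ if every collider node on $\pi$ is in $\mathrm{An}(C)$ and every non-collider node $k$ on $\pi$ is outside $C$, unless $\pi$ has a subpath $h\cdots k\cdots l$ and ($\mathrm{sp}(k)\neq\varnothing$ or $\mathrm{pa}(k)\setminus C\neq\varnothing$); $A,B$ are $z$-separated by $C$ if there is no $z$-connecting path given $C$ between them. Route criterion for alternative ADMGs: a node $k$ on a route is a collider if $h\to k\leftarrow l$ or $h\to k\cdots l$ (in either orientation; possibly $h=l$) is a subroute; a route is connecting given $C$ if every collider on it is in $C$ and every non-collider on it is outside $C$; $A,B$ are separated by $C$ if there is no such connecting route between them. *)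

(* Defs.v *)
From HB Require Import structures.
From mathcomp Require Import all_boot.
Set Implicit Arguments.
Unset Strict Implicit.
Unset Printing Implicit Defensive.

Inductive edge_kind := Line | Arrow | Arc | Dotted.

Definition edge_kind_code (t : edge_kind) : nat :=
  match t with Line => 0 | Arrow => 1 | Arc => 2 | Dotted => 3 end.
Definition edge_kind_decode (n : nat) : edge_kind :=
  match n with 0 => Line | 1 => Arrow | 2 => Arc | _ => Dotted end.
Lemma edge_kind_codeK : cancel edge_kind_code edge_kind_decode.
Proof. by case. Qed.
HB.instance Definition _ := Countable.copy edge_kind (can_type edge_kind_codeK).

(* Edges form a type of their own, so that parallel edges, of equal or of
   different kinds, are allowed.  An arrow is directed from [src] to [tgt]; for
   the other kinds the order of the two endpoints carries no information. *)
Record mixed_graph (V E : finType) := MixedGraph {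
  kind : E -> edge_kind;
  src : E -> V;
  tgt : E -> V;
  no_loop : forall e, src e != tgt e }.

Section Graph.
Variables (V E : finType) (G : mixed_graph V E).

Definition endpoint (e : E) (i : V) : bool := (i == src G e) || (i == tgt G e).

Definition joins (e : E) (i j : V) : bool :=
  ((src G e == i) && (tgt G e == j)) || ((src G e == j) && (tgt G e == i)).

Definition arrow_to (e : E) (k : V) : bool :=
  (kind G e == Arrow) && (tgt G e == k).

Definition arrowhead_at (e : E) (k : V) : bool :=
  arrow_to e k || ((kind G e == Arc) && endpoint e k).

Definition pa (k : V) : {set V} :=
  [set l | [exists e, [&& kind G e == Arrow, src G e == l & tgt G e == k]]].

Definition sp (k : V) : {set V} :=
  [set l | [exists e, (kind G e == Arc) && joins e l k]].

(* The walk <i_0, e_1, i_1, ..., e_n, i_n> is given by its first node i_0 and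
   the sequence of pairs (e_1, i_1), ..., (e_n, i_n). *)
Notation steps := (seq (E * V)).

Fixpoint walk (x : V) (p : steps) : bool :=
  if p is (e, y) :: p' then joins e x y && walk y p' else true.

Definition nodes (x : V) (p : steps) : seq V := x :: unzip2 p.
Definition final (x : V) (p : steps) : V := last x (unzip2 p).
Definition first_edge (p : steps) : option E := ohead (unzip1 p).
Definition last_edge (p : steps) : option E := ohead (rev (unzip1 p)).

Definition is_path (x : V) (p : steps) : bool := walk x p && uniq (nodes x p).

Definition closed_walk (x : V) (p : steps) : bool :=
  walk x p && (final x p == x).

Definition is_cycle (x : V) (p : steps) : bool :=
  [&& closed_walk x p, 2 <= size p & uniq (unzip2 p)].

Definition of_kind (t : edge_kind) (st : E * V) : bool := kind G st.1 == t.

(* As there are no loops, a step (e, y) of a walk along an arrow e goes forward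
   exactly when y is the head of e. *)
Definition arrow_forward (st : E * V) : bool :=
  of_kind Arrow st ==> (tgt G st.1 == st.2).

Definition directed_walk (x : V) (p : steps) : bool :=
  walk x p && all (fun st => of_kind Arrow st && arrow_forward st) p.

Definition semi_directed_walk (x : V) (p : steps) : bool :=
  [&& walk x p, has (of_kind Arrow) p, ~~ has (of_kind Arc) p
    & all arrow_forward p].

Definition anterior_walk (x : V) (p : steps) : bool :=
  semi_directed_walk x p || (walk x p && all (of_kind Line) p).

Definition ancestor (i j : V) : Prop :=
  exists p, directed_walk i p /\ final i p = j.

(* The empty walk accounts for the inclusion of C in An(C). *)
Definition An (C : {set V}) (i : V) : Prop := exists2 c, c \in C & ancestor i c.

Definition anterior (i j : V) : Prop :=
  exists p, anterior_walk i p /\ final i p = j.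

(* The edges e and f are met by the walk just before node k and just after
   node l; k and l are the two extremities of a section (k = l for a single
   node). *)
Definition collider_edges (e : E) (k : V) (f : E) (l : V) : bool :=
  [|| arrowhead_at e k && arrowhead_at f l,
      arrowhead_at e k && (kind G f == Dotted)
    | (kind G e == Dotted) && arrowhead_at f l].

Definition not_line (oe : option E) : bool :=
  if oe is Some e then kind G e != Line else true.

(* Sections are occurrences in the walk: p is cut as p1 ++ s ++ p2, and the
   section is the subwalk with first node [final x p1] and steps s. *)
Definition is_section (p p1 s p2 : steps) : Prop :=
  [/\ p = p1 ++ s ++ p2, all (of_kind Line) s,
      not_line (last_edge p1) & not_line (first_edge p2)].

Definition section_nodes (x : V) (p1 s : steps) : seq V :=
  nodes (final x p1) s.

(* It is an endpoint section exactly when p1 or p2 is empty. *)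
Definition collider_section (x : V) (p1 s p2 : steps) : bool :=
  match last_edge p1, first_edge p2 with
  | Some e, Some f =>
      collider_edges e (final x p1) f (final (final x p1) s)
  | _, _ => false
  end.

(* The equality of booleans says that collider sections intersect C and all
   other sections are disjoint from C. *)
Definition connecting (C : {set V}) (x : V) (p : steps) : Prop :=
  forall p1 s p2, is_section p p1 s p2 ->
    has (mem C) (section_nodes x p1 s) = collider_section x p1 s p2.

Definition joins_sets (A B : {set V}) (x : V) (p : steps) : Prop :=
  [/\ x \in A, final x p \in B & walk x p].

Definition separated (A B C : {set V}) : Prop :=
  ~ exists x p, joins_sets A B x p /\ connecting C x p.

(* A node occurrence on a walk is a cut p = p1 ++ p2; the node is
   [final x p1]. *)
Definition collider_node (x : V) (p1 p2 : steps) : bool :=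
  match last_edge p1, first_edge p2 with
  | Some e, Some f => collider_edges e (final x p1) f (final x p1)
  | _, _ => false
  end.

Definition m_connecting (C : {set V}) (x : V) (p : steps) : Prop :=
  forall p1 p2, p = p1 ++ p2 ->
    if collider_node x p1 p2 then An C (final x p1) else final x p1 \notin C.

Definition m_separated (A B C : {set V}) : Prop :=
  ~ exists x p, [/\ joins_sets A B x p, is_path x p & m_connecting C x p].

Definition arrowheads_meet (x : V) (p1 s p2 : steps) : bool :=
  match last_edge p1, first_edge p2 with
  | Some e, Some f =>
      arrowhead_at e (final x p1) && arrowhead_at f (final (final x p1) s)
  | _, _ => false
  end.

Definition c_connecting (C : {set V}) (x : V) (p : steps) : Prop :=
  forall p1 s p2, is_section p p1 s p2 ->
    has (mem C) (section_nodes x p1 s) = arrowheads_meet x p1 s p2.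

Definition c_separated (A B C : {set V}) : Prop :=
  ~ exists x p, joins_sets A B x p /\ c_connecting C x p.

Definition between_dotted (p1 p2 : steps) : bool :=
  match last_edge p1, first_edge p2 with
  | Some e, Some f => (kind G e == Dotted) && (kind G f == Dotted)
  | _, _ => false
  end.

Definition z_connecting (C : {set V}) (x : V) (p : steps) : Prop :=
  forall p1 p2, p = p1 ++ p2 ->
    let k := final x p1 in
    if collider_node x p1 p2 then An C k
    else k \notin C \/
         between_dotted p1 p2 /\ (sp k <> set0 \/ pa k :\: C <> set0).

Definition z_separated (A B C : {set V}) : Prop :=
  ~ exists x p, [/\ joins_sets A B x p, is_path x p & z_connecting C x p].

Definition route_collider (x : V) (p1 p2 : steps) : bool :=
  match last_edge p1, first_edge p2 with
  | Some e, Some f =>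
      let k := final x p1 in
      [|| arrow_to e k && arrow_to f k,
          arrow_to e k && (kind G f == Dotted)
        | (kind G e == Dotted) && arrow_to f k]
  | _, _ => false
  end.

(* Collider status belongs to an occurrence of a node on the route: the same
   node may occur once as a collider and once as a non-collider. *)
Definition route_connecting (C : {set V}) (x : V) (p : steps) : Prop :=
  forall p1 p2, p = p1 ++ p2 ->
    (final x p1 \in C) = route_collider x p1 p2.

Definition route_separated (A B C : {set V}) : Prop :=
  ~ exists x p, joins_sets A B x p /\ route_connecting C x p.

Definition no_kind (t : edge_kind) : Prop := forall e, kind G e <> t.

Definition only_kinds (ts : seq edge_kind) : Prop :=
  forall e, kind G e \in ts.

Definition no_arrowhead_at_line : Prop :=
  forall e f k, arrowhead_at e k -> kind G f = Line -> ~~ endpoint f k.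

Definition chain_mixed_graph : Prop :=
  no_kind Dotted /\ ~ exists x p, is_cycle x p /\ semi_directed_walk x p.

Definition summary_graph : Prop := chain_mixed_graph /\ no_arrowhead_at_line.

Definition ancestral_graph : Prop :=
  summary_graph /\
  forall e i j, kind G e = Arc -> joins e i j -> ~ ancestor i j.

Definition ADMG : Prop := summary_graph /\ no_kind Line.

Definition anterial_graph : Prop :=
  chain_mixed_graph /\
  forall e i j, kind G e = Arc -> joins e i j -> ~ anterior i j.

Definition undirected_graph : Prop := only_kinds [:: Line].
Definition bidirected_graph : Prop := only_kinds [:: Arc].
Definition dotted_line_graph : Prop := only_kinds [:: Dotted].

Definition DAG : Prop :=
  only_kinds [:: Arrow] /\ ~ exists x p, is_cycle x p /\ directed_walk x p.

Definition marginal_AMP_graph : Prop :=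
  [/\ no_kind Line,
      ~ exists x p, [/\ closed_walk x p, has (of_kind Arrow) p
                      & all arrow_forward p],
      ~ exists x p, [/\ is_cycle x p, count (of_kind Arc) p = 1
                      & all (fun st => of_kind Arc st || of_kind Dotted st) p]
    & forall e f g i j k,
        kind G e = Dotted -> joins e i j ->
        kind G f = Dotted -> joins f j k -> i != k ->
        kind G g = Arc -> endpoint g j ->
        exists2 h, kind G h = Dotted & joins h i k].

Definition linked_without_arrow (i j : V) : bool :=
  [exists e, (kind G e != Arrow) && joins e i j].

Definition chain_component (i : V) : {set V} :=
  [set j | connect linked_without_arrow i j].

Definition arrow_of : finType := {e : E | kind G e == Arrow}.

End Graph.

(* The graph H obtained by contracting the chain components has the set of
   components as nodes and the arrows of G as edges; sets of nodes of G that
   are not chain components are isolated nodes of H, which is harmless.  That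
   H is a [mixed_graph] excludes arrows inside a chain component. *)
Definition chain_graph (V E : finType) (G : mixed_graph V E) : Prop :=
  (forall e f, kind G e <> Arrow -> kind G f <> Arrow ->
     chain_component G (src G e) = chain_component G (src G f) ->
     kind G e = kind G f) /\
  (exists H : mixed_graph {set V} (arrow_of G),
     DAG H /\
     forall a, src H a = chain_component G (src G (val a)) /\
               tgt H a = chain_component G (tgt G (val a))).

Section ChainGraph.
Variables (V E : finType) (G : mixed_graph V E).

Definition undirected_chain_graph : Prop :=
  chain_graph G /\ only_kinds G [:: Line; Arrow].
Definition bidirected_chain_graph : Prop :=
  chain_graph G /\ only_kinds G [:: Arc; Arrow].
Definition dotted_line_chain_graph : Prop :=
  chain_graph G /\ only_kinds G [:: Dotted; Arrow].

Definition regression_graph : Prop :=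
  [/\ chain_graph G, only_kinds G [:: Line; Arc; Arrow]
    & no_arrowhead_at_line G].

Definition alternative_ADMG : Prop :=
  exists H : mixed_graph V E,
    ADMG H /\
    forall e, [/\ src G e = src H e, tgt G e = tgt H e
                & kind G e = if kind H e == Arc then Dotted else kind H e].

End ChainGraph.

(* Main.v *)
(* In parts (2) and (4) the two criteria already have the same connecting walks.
   Parts (1) and (3) are instances of one equivalence, valid in every graph in
   which no arrowhead meets a line, no directed walk is closed, and dotted
   neighbours of an endpoint of an arc are joined by a dotted line.  In such a
   graph a collider section is a single node, so separation is a condition on
   node occurrences.  A connecting walk satisfies the z-conditions, and a
   shortest walk satisfying the z-conditions is a path on which no node of C
   that has spouses lies between two dotted lines.  Conversely such a path
   becomes a connecting walk when a round trip to C along arrows is inserted at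
   each collider outside C, and a round trip to a parent outside C at each node
   of C lying between two dotted lines. *)
Require Import Defs.
From mathcomp Require Import all_boot.
Set Implicit Arguments.
Unset Strict Implicit.
Unset Printing Implicit Defensive.

Section Walks.
Variables (V E : finType) (G : mixed_graph V E).
Local Notation steps := (seq (E * V)).
Implicit Types (x y k : V) (e f g : E) (oe oo : option E) (p q : steps).

(** * Edges, cuts of walks and repeated nodes *)

Lemma joins_sym e x y : joins G e x y = joins G e y x.
Proof. by rewrite /joins orbC. Qed.

Lemma joins_neq e x y : joins G e x y -> x != y.
Proof.
case/orP=> /andP [/eqP sx /eqP ty]; rewrite -sx -ty ?[tgt _ _ == _]eq_sym;
exact: no_loop.
Qed.

Lemma joins_endpointl e x y : joins G e x y -> endpoint G e x.
Proof.
by case/orP=> /andP [/eqP s1 /eqP s2]; rewrite /endpoint ?s1 ?s2 eqxx ?orbT.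
Qed.

Lemma joins_endpointr e x y : joins G e x y -> endpoint G e y.
Proof. by rewrite joins_sym; apply: joins_endpointl. Qed.

Lemma walk_cat x p q :
  walk G x (p ++ q) = walk G x p && walk G (final x p) q.
Proof. by elim: p x => [|[e y] p IH] x //=; rewrite IH andbA. Qed.

Lemma final_cat x p q : final x (p ++ q) = final (final x p) q.
Proof. by rewrite /final /unzip2 map_cat last_cat. Qed.

Lemma nodes_split x p y : y \in nodes x p ->
  exists p1 p2, p = p1 ++ p2 /\ final x p1 = y.
Proof.
elim: p x => [|[e z] p IH] x; rewrite inE.
  by move=> /eqP ->; exists [::], [::].
case/orP=> [/eqP ->|/IH [p1 [p2 [-> <-]]]]; first by exists [::], ((e, z) :: p).
by exists ((e, z) :: p1), p2.
Qed.

Lemma uniq_nodes_cat x p q :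
  uniq (nodes x (p ++ q)) -> uniq (nodes (final x p) q).
Proof.
rewrite /nodes /unzip2 map_cat -cat_cons lastI cat_rcons cat_uniq.
by case/and3P.
Qed.

Lemma nonuniq_nodes_loop x p : ~~ uniq (nodes x p) ->
  exists p1 p2 p3, [/\ p = p1 ++ p2 ++ p3, p2 != [::]
    & final (final x p1) p2 = final x p1].
Proof.
elim: p x => [|[e y] p IH] x //.
rewrite /= negb_and negbK; case/orP=> [/(nodes_split (p := p))|/IH].
  by move=> [q1 [q2 [-> eqx]]]; exists [::], ((e, y) :: q1), q2.
by move=> [p1 [p2 [p3 [-> ? ?]]]]; exists ((e, y) :: p1), p2, p3.
Qed.

(** * Directed walks and acyclicity *)

Definition tail_at e x := (kind G e == Arrow) && (src G e == x).

(** Unlike [ancestor], this excludes the empty walk, so that acyclicity reads [~ dreach x x]. *)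
Definition dreach x y :=
  exists p, [/\ p != [::], directed_walk G x p & final x p = y].

(** As there are no loops, an arrow joining [x] and [y] has its head at [y] exactly when its tail is
    at [x]. *)
Lemma directed_walk_cons x e y p :
  directed_walk G x ((e, y) :: p) =
  [&& joins G e x y, tail_at e x & directed_walk G y p].
Proof.
rewrite /directed_walk /= /of_kind /arrow_forward /of_kind /tail_at /joins /=.
case: (kind G e == Arrow); rewrite /= ?andbF //.
have nl := no_loop G e.
case: (eqVneq (src G e) x) => [sx|nsx]; case: (eqVneq (tgt G e) y) => [ty|nty];
  rewrite /= ?andbT ?andbF ?orbF //=.
- by case: (eqVneq (tgt G e) x) nl => [tx|]; rewrite ?andbF // sx tx eqxx.
by case: (eqVneq (src G e) y) nl => [sy|]; rewrite // sy ty eqxx.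
Qed.

Lemma dreach1 e x y : joins G e x y -> tail_at e x -> dreach x y.
Proof.
by move=> exy ex; exists [:: (e, y)]; rewrite directed_walk_cons exy ex.
Qed.

Lemma dreach_cons e x y z :
  joins G e x y -> tail_at e x -> dreach y z -> dreach x z.
Proof.
move=> exy ex [p [_ dp fp]].
by exists ((e, y) :: p); rewrite directed_walk_cons exy ex.
Qed.

(** If [x] recurs in the shortened tail, everything before the recurrence is dropped. *)
Lemma directed_walk_shorten x p : directed_walk G x p ->
  exists q, [/\ directed_walk G x q, final x q = final x p
              & uniq (nodes x q)].
Proof.
elim: p x => [|[e y] p IH] x; first by exists [::].
rewrite directed_walk_cons => /and3P [exy ex /IH [q [dq fq uq]]].
have [xq|xq] := boolP (x \in nodes y q); last first.
  exists ((e, y) :: q); rewrite directed_walk_cons exy ex dq.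
  by split=> //; rewrite /nodes /= xq.
have [q1 [q2 [eq_q eqx]]] := nodes_split xq.
exists q2; move: dq fq uq.
rewrite eq_q /directed_walk walk_cat all_cat final_cat eqx.
case/andP=> /andP [_ ->] /andP [_ ->] fq /uniq_nodes_cat.
by rewrite eqx => uq; split.
Qed.

(** The first arrow of a closed directed walk, followed by the shortened rest, is a directed
    cycle. *)
Lemma acyclic_dreach :
  ~ (exists x p, is_cycle G x p /\ directed_walk G x p) ->
  forall x, ~ dreach x x.
Proof.
move=> acyc x [[|[e y] p] [] //= _].
rewrite directed_walk_cons => /and3P [exy ex].
case/directed_walk_shorten=> q [dq fq uq] fp.
apply: acyc; exists x, ((e, y) :: q).
rewrite directed_walk_cons exy ex dq; split=> //.
have wq : walk G y q by case/andP: dq.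
have fqx : final x ((e, y) :: q) = x by rewrite -[RHS]fp; exact: fq.
rewrite /is_cycle /closed_walk /= exy wq fqx eqxx /=.
apply/andP; split; last exact: uq.
(* With [q] empty, [e] would be a loop; hence the cycle has at least two edges. *)
case: q fqx {dq uq wq fq} => // fqx.
by have := joins_neq exy; rewrite -[X in X != _]fqx eqxx.
Qed.

Lemma directed_walk_semi x p :
  p != [::] -> directed_walk G x p -> semi_directed_walk G x p.
Proof.
move=> p0 /andP [wp dp]; apply/and4P; split=> //.
- by case: p p0 dp {wp} => [|[e y] p] //= _ /andP [/andP [-> _] _].
- apply/hasPn => st /(allP dp) /andP [/eqP ka _].
  by rewrite /of_kind ka.
- by apply/allP => st /(allP dp) /andP [].
Qed.

Lemma summary_dreach x : chain_mixed_graph G -> ~ dreach x x.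
Proof.
case=> _ acyc; apply: acyclic_dreach => -[y [p [cy dp]]].
apply: acyc; exists y, p; split=> //; apply: directed_walk_semi => //.
by case: p cy {dp} => // /and3P [].
Qed.

Lemma forward_closed_dreach x :
  ~ (exists x p, [/\ closed_walk G x p, has (of_kind G Arrow) p
                   & all (arrow_forward G) p]) -> ~ dreach x x.
Proof.
move=> nc [p [p0 dp fp]]; apply: nc; exists x, p.
have /and4P [wp ha _ fw] := directed_walk_semi p0 dp.
by rewrite /closed_walk wp fp eqxx.
Qed.

(** * Conditions on node occurrences along a walk *)

Section NodeConditions.

(* [Q oe k oo] is a condition on an occurrence of k on a walk, between the
   edges oe and oo; None stands for an end of the walk.  [at_nodes Q oe x p]
   states it along p as if p were preceded by oe; [at_starts] omits the last
   node. *)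
Variable Q : option E -> V -> option E -> Prop.

Fixpoint at_nodes oe x p : Prop :=
  if p is (e, y) :: p' then Q oe x (Some e) /\ at_nodes (Some e) y p'
  else Q oe x None.

Fixpoint at_starts oe x p : Prop :=
  if p is (e, y) :: p' then Q oe x (Some e) /\ at_starts (Some e) y p'
  else True.

Definition prev oe p := last oe (map Some (unzip1 p)).

Lemma prev_cat oe p q : prev oe (p ++ q) = prev (prev oe p) q.
Proof. by rewrite /prev /unzip1 !map_cat last_cat. Qed.

Lemma prev_rcons oe p e y : prev oe (rcons p (e, y)) = Some e.
Proof. by rewrite -cats1 prev_cat. Qed.

Lemma last_edge_prev p : last_edge p = prev None p.
Proof.
case/lastP: p => // p [e y].
by rewrite prev_rcons /last_edge /unzip1 map_rcons rev_rcons.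
Qed.

Lemma at_starts_cat oe x p q :
  at_starts oe x (p ++ q) <->
  at_starts oe x p /\ at_starts (prev oe p) (final x p) q.
Proof.
elim: p oe x => [|[e y] p IH] oe x /=; first by split=> [|[]].
by have := IH (Some e) y; rewrite /prev /final /=; tauto.
Qed.

Lemma at_nodes_cat oe x p q :
  at_nodes oe x (p ++ q) <->
  at_starts oe x p /\ at_nodes (prev oe p) (final x p) q.
Proof.
elim: p oe x => [|[e y] p IH] oe x /=; first by split=> [|[]].
by have := IH (Some e) y; rewrite /prev /final /=; tauto.
Qed.

Lemma at_nodes_head oe x p : at_nodes oe x p -> Q oe x (first_edge p).
Proof. by case: p => [|[e y] p] //= []. Qed.

(** Only the condition at the first node sees the edge preceding the walk. *)
Lemma at_nodes_rehead oe oe' x p :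
  at_nodes oe x p -> Q oe' x (first_edge p) -> at_nodes oe' x p.
Proof. by case: p => [|[e y] p] //= []. Qed.

(** Links the recursive form, suited to induction and concatenation, to the quantification over cuts
    used in the separation criteria. *)
Lemma at_nodesP x p :
  at_nodes None x p <->
  (forall p1 p2, p = p1 ++ p2 ->
     Q (last_edge p1) (final x p1) (first_edge p2)).
Proof.
split=> [Qp p1 p2 eqp|Qp].
  rewrite last_edge_prev; apply: at_nodes_head.
  by move: Qp; rewrite eqp => /at_nodes_cat [].
suff gen p1 p2 : p = p1 ++ p2 -> at_nodes (prev None p1) (final x p1) p2.
  exact: (gen [::] p).
elim: p2 p1 => [|[e y] p2 IH] p1 eqp.
  by rewrite -last_edge_prev; apply: (Qp _ _ eqp).
split; first by rewrite -last_edge_prev; apply: (Qp _ _ eqp).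
have := IH (rcons p1 (e, y)).
by rewrite prev_rcons -cats1 final_cat -catA; apply.
Qed.

End NodeConditions.

Lemma at_nodes_dichotomy (Q Q' B : option E -> V -> option E -> Prop) oe x p :
  (forall oe k oo, Q oe k oo -> Q' oe k oo \/ B oe k oo) ->
  at_nodes Q oe x p ->
  at_nodes Q' oe x p \/
  exists p1 p2, p = p1 ++ p2 /\ B (prev oe p1) (final x p1) (first_edge p2).
Proof.
move=> QB; elim: p oe x => [|[e y] p IH] oe x /=.
  by case/QB=> ?; [left | right; exists [::], [::]].
case=> /QB [Q'x|Bx]; last by right; exists [::], ((e, y) :: p).
case/IH=> [?|[p1 [p2 [-> Bp]]]]; first by left.
by right; exists ((e, y) :: p1), p2.
Qed.

(** * Collider status and the ends of an edge *)

Definition collider_at oe k oo : bool :=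
  match oe, oo with
  | Some e, Some f => collider_edges G e k f k
  | _, _ => false
  end.

Definition dotted_at oe oo : bool :=
  match oe, oo with
  | Some e, Some f => (kind G e == Dotted) && (kind G f == Dotted)
  | _, _ => false
  end.

Lemma collider_atC oe k oo : collider_at oe k oo = collider_at oo k oe.
Proof.
case: oe oo => [e|] [f|] //=; rewrite /collider_edges.
by do 2!case: (arrowhead_at _ _ _); do 2!case: (_ == Dotted).
Qed.

Lemma line_arrowhead e k : kind G e = Line -> arrowhead_at G e k = false.
Proof. by rewrite /arrowhead_at /arrow_to => ->. Qed.

Lemma dotted_arrowhead k e : kind G e = Dotted -> arrowhead_at G e k = false.
Proof. by rewrite /arrowhead_at /arrow_to => ->. Qed.

Lemma tail_arrowhead e k : tail_at e k -> arrowhead_at G e k = false.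
Proof.
case/andP=> /eqP ka /eqP <-; rewrite /arrowhead_at /arrow_to ka /= orbF.
by rewrite eq_sym (negbTE (no_loop G e)).
Qed.

Lemma tail_collider_at e k oo :
  tail_at e k -> collider_at (Some e) k oo = false.
Proof.
move=> te; case: oo => //= f; rewrite /collider_edges tail_arrowhead //.
by case/andP: te => /eqP ->.
Qed.

Variant end_spec e k : Prop :=
  | EndHead of arrowhead_at G e k
  | EndDotted of kind G e = Dotted
  | EndLine of kind G e = Line
  | EndTail of tail_at e k.

Lemma endP e k : endpoint G e k -> end_spec e k.
Proof.
move=> ek; case ke: (kind G e).
- exact: EndLine.
- case/orP: (ek) => /eqP kE.
    by apply: EndTail; rewrite /tail_at ke kE !eqxx.
  by apply: EndHead; rewrite /arrowhead_at /arrow_to ke kE !eqxx.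
- by apply: EndHead; rewrite /arrowhead_at ke ek orbT.
- exact: EndDotted.
Qed.

Lemma tail_head e x y : joins G e x y -> tail_at e x -> arrowhead_at G e y.
Proof.
move=> exy ex.
case: (endP (joins_endpointr exy)) => // [ke|ke|/andP [_ /eqP sy]].
- by case/andP: ex; rewrite ke.
- by case/andP: ex; rewrite ke.
- by have := joins_neq exy; case/andP: ex => _ /eqP <-; rewrite sy eqxx.
Qed.

Lemma head_collider_at e f k : arrowhead_at G e k ->
  arrowhead_at G f k \/ kind G f = Dotted -> collider_at (Some e) k (Some f).
Proof. by rewrite /= /collider_edges => -> [->|->] //=; rewrite orbT. Qed.

(** * Sections reduced to single nodes *)

Section Separation.
Hypothesis head_line : no_arrowhead_at_line G.
Variable C : {set V}.

(** As [collider_at] is false next to [None], the two ends of a walk have to avoid [C]. *)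
Definition node_open oe k oo := (k \in C) = collider_at oe k oo.

Lemma line_prefix p : exists s q,
  [/\ p = s ++ q, all (of_kind G Line) s & not_line G (first_edge q)].
Proof.
elim: p => [|[e y] p [s [q [-> ls nq]]]]; first by exists [::], [::].
have [ke|ke] := boolP (kind G e == Line).
  by exists ((e, y) :: s), q; rewrite /= ls andbT.
by exists [::], ((e, y) :: s ++ q).
Qed.

Lemma line_suffix p : exists q s,
  [/\ p = q ++ s, all (of_kind G Line) s & not_line G (last_edge q)].
Proof.
elim/last_ind: p => [|p [e y] [q [s [-> ls nq]]]]; first by exists [::], [::].
have [ke|ke] := boolP (kind G e == Line).
  by exists q, (rcons s (e, y)); rewrite rcons_cat all_rcons ls andbT.
exists (rcons (q ++ s) (e, y)), [::]; rewrite cats0; split=> //.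
by rewrite last_edge_prev prev_rcons.
Qed.

Lemma line_section_no_arrowhead x s : s != [::] -> walk G x s ->
    all (of_kind G Line) s ->
  forall k, k \in nodes x s -> forall e, arrowhead_at G e k = false.
Proof.
move=> s0 ws ls k ks e; apply/negP => ek.
suff [f kf fk] : exists2 f, kind G f = Line & endpoint G f k.
  by have := head_line ek kf; rewrite fk.
elim: s x {s0} ws ls ks (s0) => [|[f y] s IH] x //= /andP [fxy ws].
case/andP=> /eqP kf ls; rewrite inE => /orP [/eqP -> _|ks _].
  by exists f => //; apply: joins_endpointl fxy.
have [s0|s0] := eqVneq s [::]; last exact: IH ks s0.
exists f => //; move: ks; rewrite s0 inE => /eqP ->.
exact: joins_endpointr fxy.
Qed.

(** No arrowhead meets a section containing a line. Such a section is therefore non-collider, as is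
    each of its node occurrences, and both conditions put all its nodes outside [C]. On a
    single-node section the two conditions coincide. *)
Lemma connecting_at_nodes x p : walk G x p ->
  (connecting G C x p <-> at_nodes node_open None x p).
Proof.
move=> wp; split=> [cp|/at_nodesP np p1 s p2 [eqp ls np1 np2]].
- apply/at_nodesP => p1 p2 eqp.
  (* The section through this occurrence consists of the maximal runs of lines on its two sides. *)
  have [q1 [s1 [eq1 ls1 nq1]]] := line_suffix p1.
  have [s2 [q2 [eq2 ls2 nq2]]] := line_prefix p2.
  have sec : is_section G p q1 (s1 ++ s2) q2.
    by split; rewrite // ?all_cat ?ls1 // eqp eq1 eq2 -!catA.
  have := cp _ _ _ sec.
  have [s0|s0] := eqVneq (s1 ++ s2) [::].
    move: s0 eq1 eq2; case: (s1) => // /= ->; rewrite cats0 => <- /= <-.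
    by rewrite /= orbF.
  have wS : walk G (final x q1) (s1 ++ s2).
    move: wp; rewrite eqp eq1 eq2 -catA catA -!catA (catA s1) !walk_cat.
    by case/and3P.
  have lS : all (of_kind G Line) (s1 ++ s2) by rewrite all_cat ls1.
  have hS := line_section_no_arrowhead s0 wS lS.
  have -> : collider_section G x q1 (s1 ++ s2) q2 = false.
    rewrite /collider_section.
    case: (last_edge q1) (first_edge q2) => [e|] [f|] //.
    rewrite /collider_edges !hS ?andbF ?mem_head //.
    by rewrite /final /nodes mem_last.
  have kS : final x p1 \in nodes (final x q1) (s1 ++ s2).
    rewrite eq1 final_cat {1}/final /nodes /unzip2 map_cat -cat_cons mem_cat.
    by rewrite mem_last.
  move/hasPn/(_ _ kS)/negbTE; rewrite /node_open /= => ->.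
  case: (last_edge p1) (first_edge p2) => [e|] [f|] //=.
  by rewrite /collider_edges !(hS _ kS) ?andbF.
- have [s0|s0] := eqVneq s [::].
    have := np p1 p2; rewrite eqp s0 /= orbF => -> //.
  have ws : walk G (final x p1) s.
    by move: wp; rewrite eqp !walk_cat; case/and3P.
  have hs := line_section_no_arrowhead s0 ws ls.
  rewrite /collider_section.
  transitivity false; last first.
    case: (last_edge p1) (first_edge p2) => [e|] [f|] //.
    rewrite /collider_edges !hs ?andbF ?mem_head //.
    by rewrite /final /nodes mem_last.
  (* Each node of the section gives a cut of the walk, to which the node condition applies. *)
  apply/negbTE/hasPn => y ys; have [s1 [s2 [eqs eqy]]] := nodes_split ys.
  have := np (p1 ++ s1) (s2 ++ p2); rewrite eqp eqs -!catA.
  move/(_ erefl); rewrite /node_open final_cat eqy /= => ->.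
  case: (last_edge _) (first_edge _) => [e|] [f|] //=.
  by rewrite /collider_edges !(hs _ ys) ?andbF.
Qed.

(** * The z-conditions and the reversal of walks *)

Definition z_open oe k oo : Prop :=
  if collider_at oe k oo then An G C k
  else k \notin C \/
       dotted_at oe oo /\ (sp G k <> set0 \/ pa G k :\: C <> set0).

Lemma z_openC oe k oo : z_open oe k oo -> z_open oo k oe.
Proof.
rewrite /z_open collider_atC.
suff -> : dotted_at oo oe = dotted_at oe oo by [].
by case: oe oo => [e|] [f|] //=; rewrite andbC.
Qed.

Lemma z_connectingP x p : z_connecting G C x p <-> at_nodes z_open None x p.
Proof. by have [] := at_nodesP z_open x p; split. Qed.

Lemma An_sub k : k \in C -> An G C k.
Proof. by exists k => //; exists [::]. Qed.

Lemma An_cons e x y : joins G e x y -> tail_at e x -> An G C y -> An G C x.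
Proof.
move=> exy ex [c cC [p [dp fp]]]; exists c => //.
by exists ((e, y) :: p); rewrite directed_walk_cons exy ex.
Qed.

Lemma node_open_z oe x p : at_nodes node_open oe x p -> at_nodes z_open oe x p.
Proof.
have Q_Q o1 k o2 : node_open o1 k o2 -> z_open o1 k o2.
  rewrite /z_open => <-; have [kC|kC] := boolP (k \in C); last by left.
  exact: An_sub.
elim: p oe x => [|[e y] p IH] oe x /=; first exact: Q_Q.
by case=> /Q_Q Qx /IH.
Qed.

(* The walk follows arrows until it meets a collider, which lies in An(C). *)
Lemma follow_arrows oe e x y p :
    walk G x ((e, y) :: p) -> at_starts z_open oe x ((e, y) :: p) ->
    tail_at e x ->
  An G C x \/ dreach x (final y p).
Proof.
elim: p oe e x y => [|[f z] p IH] oe e x y /=.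
  by rewrite andbT => exy _ ex; right; apply: dreach1 exy ex.
case/and3P=> exy fyz wp [_ [Qy Qp]] ex.
have ey := tail_head exy ex.
case: (endP (joins_endpointl fyz)) => [fy|kf|kf|fy].
- left; apply: (An_cons exy ex).
  by move: Qy; rewrite /z_open head_collider_at //; left.
- left; apply: (An_cons exy ex).
  by move: Qy; rewrite /z_open head_collider_at //; right.
- by have := head_line ey kf; rewrite (joins_endpointl fyz).
- case: (IH (Some e) f y z _ _ fy) => /= [|||yz]; rewrite ?fyz //.
    by left; apply: An_cons exy ex _.
  by right; apply: dreach_cons exy ex _.
Qed.

(** The reversed walk, whose first node is [final x p]. *)
Fixpoint rev_walk x p : steps :=
  if p is (e, y) :: p' then rcons (rev_walk y p') (e, x) else [::].

Lemma rev_walk_final x p : final (final x p) (rev_walk x p) = x.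
Proof.
case: p => //= -[e y] p.
by rewrite -cats1 final_cat.
Qed.

Lemma walk_rev x p : walk G x p -> walk G (final x p) (rev_walk x p).
Proof.
elim: p x => //= -[e y] p IH x /andP [exy wp].
rewrite -cats1 walk_cat -[final x _]/(final y p) rev_walk_final /= joins_sym.
by rewrite exy IH.
Qed.

(** [z_open] is symmetric in the two edges. The conditions at the two extremities are carried
    separately, since [at_starts] omits the last node. *)
Lemma at_starts_rev x p oe oo :
  at_starts z_open oe x p -> z_open (prev oe p) (final x p) oo ->
  at_starts z_open oo (final x p) (rev_walk x p) /\
  z_open (prev oo (rev_walk x p)) x oe.
Proof.
elim: p x oe => [|[e y] p IH] x oe /=; first by move=> _ /z_openC.
case=> Qx Qp Qf; have [Rp Ry] := IH y (Some e) Qp Qf.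
rewrite prev_rcons; split; last exact: z_openC.
rewrite -cats1; apply/at_starts_cat; split=> //.
by split=> //; rewrite -[final x _]/(final y p) rev_walk_final.
Qed.

(** * Shortening walks under the z-conditions *)

Section Excision.
Hypothesis acyclic : forall x, ~ dreach x x.

(** The loop is entered through an arrowhead at [k]. If it leaves [k] by an arrowhead or a dotted
    line, [k] is a collider. If it leaves along an arrow, following arrows reaches [An G C], as
    otherwise the loop would be a closed directed walk. *)
Lemma head_loop e k p :
    p != [::] -> walk G k p -> final k p = k ->
    at_starts z_open (Some e) k p -> arrowhead_at G e k ->
  An G C k.
Proof.
case: p => // -[f y] p _ wp fp Qp ek; have [Qk _] := Qp.
have [fky _] := andP wp.
case: (endP (joins_endpointl fky)) => [fk|kf|kf|fk].
- by move: Qk; rewrite /z_open head_collider_at //; left.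
- by move: Qk; rewrite /z_open head_collider_at //; right.
- by have := head_line ek kf; rewrite (joins_endpointl fky).
- case: (follow_arrows wp Qp fk) => // kk.
  by case: (@acyclic k); rewrite -{2}fp.
Qed.

(** By [z_openC], the same holds for the edge that follows [k]. *)
Lemma z_open_in oe k oo : k \in C -> z_open oe k oo ->
  exists e, oe = Some e /\ (arrowhead_at G e k \/ kind G e = Dotted).
Proof.
rewrite /z_open => ->.
case: oe oo => [e|] [f|] //=; try by case=> // -[].
case: ifP => [cef _|_ [//|[/andP [/eqP ke _] _]]]; exists e; split=> //.
  case/or3P: cef => /andP [ek _]; [by left|by left|].
  by right; apply/eqP.
by right.
Qed.

(** Cutting out a loop at [k] may change the collider status of [k]. If the outer edges form a
    collider, one of them has an arrowhead at [k], and the loop is followed from that side. If they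
    do not and [k] is in [C], both are dotted, and the loop supplies a spouse of [k] or a parent
    outside [C]. *)
Lemma z_open_excise oe k p oo :
    p != [::] -> walk G k p -> final k p = k ->
    at_starts z_open oe k p -> z_open (prev oe p) k oo ->
  z_open oe k oo.
Proof.
move=> p0 wp fp Qp Qk.
rewrite /z_open; case: ifP => [|ncol].
  case: oe oo Qp Qk => [e|] [f|] //= Qp Qk cef.
  have [ek|fk] : arrowhead_at G e k \/ arrowhead_at G f k.
    by case/or3P: cef => /andP [? ?]; [left|left|right].
  - exact: head_loop p0 wp fp Qp ek.
  (* The arrowhead is on the outgoing edge, so the loop is traversed backwards. *)
  - have Qk' : z_open (prev (Some e) p) (final k p) (Some f) by rewrite fp.
    have [Rp _] := at_starts_rev Qp Qk'.
    have wR := walk_rev wp; rewrite fp in Rp wR.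
    have fR := rev_walk_final k p; rewrite fp in fR.
    apply: head_loop _ wR fR Rp fk.
    by case: (p) p0 => // -[g y] q _ /=; case: (rev_walk _ _).
have [kC|kC] := boolP (k \in C); [right|by left].
case: p p0 wp fp Qp Qk => // -[e' y] p _ wp fp Qp Qk.
have [Qh Qp'] := Qp.
have [e [eqe eh]] := z_open_in kC Qh.
have [f [eqf fh]] := z_open_in kC (z_openC Qk).
have ed : kind G e = Dotted.
  case: eh => // ek; move: ncol; rewrite eqe eqf /= /collider_edges ek /=.
  by case: fh => ->; rewrite ?eqxx ?orbT.
have fd : kind G f = Dotted.
  case: fh => // fk; move: ncol.
  by rewrite eqe eqf /= /collider_edges fk ed eqxx !orbT.
rewrite eqe eqf /= ed fd !eqxx; split=> //.
have [e'ky wp'] := andP wp.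
(* If [k] is not a collider between [e] and [e'], its own condition gives the claim. Otherwise [e']
   has an arrowhead at [k], because [e] is dotted. *)
move: Qh; rewrite eqe /z_open; case: ifP => [|_]; last first.
  by case=> [|[]] //; rewrite kC.
rewrite /= /collider_edges dotted_arrowhead //= => /andP [_ he _].
case/orP: he => /andP [/eqP ke].
  move=> /eqP te; right; apply/eqP/set0Pn; exists y.
  have e'y : tail_at e' y.
    rewrite /tail_at ke eqxx /=.
    case/orP: e'ky => /andP [/eqP s1 /eqP s2]; last by rewrite s1.
    by have := no_loop G e'; rewrite s1 te eqxx.
  rewrite !inE; apply/andP; split; last first.
    by apply/existsP; exists e'; rewrite te eqxx andbT; apply: e'y.
  (* The loop continues beyond the parent [y], since [y] differs from [k]. The tail of [e'] at [y]
     makes this occurrence a non-collider not between dotted lines, so [y] is outside [C]. *)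
  case: p fp wp' Qp' {Qk Qp wp} => [|[g z] p] fp wp' Qp'.
    by have := joins_neq e'ky; rewrite -[X in X != _]fp eqxx.
  case: Qp' => + _; rewrite /z_open tail_collider_at //.
  by case=> // -[]; rewrite /= ke.
move=> _; left; apply/eqP/set0Pn; exists y; rewrite inE.
by apply/existsP; exists e'; rewrite ke joins_sym e'ky.
Qed.

Lemma shorten_repeat x p : walk G x p -> at_nodes z_open None x p ->
    ~~ uniq (nodes x p) ->
  exists q, [/\ size q < size p, walk G x q, final x q = final x p
              & at_nodes z_open None x q].
Proof.
move=> wp Qp /nonuniq_nodes_loop [p1 [p2 [p3 [eqp p20 loop]]]].
exists (p1 ++ p3); move: wp Qp.
rewrite eqp !walk_cat !final_cat loop !size_cat => /and3P [-> wp2 ->].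
move=> /at_nodes_cat [Q1 /at_nodes_cat [Q2 Q3]]; split=> //.
  by rewrite ltn_add2l -[X in X < _]add0n ltn_add2r; case: (p2) p20.
apply/at_nodes_cat; split=> //; rewrite loop in Q3.
apply: at_nodes_rehead (Q3) _.
exact: z_open_excise p20 wp2 loop Q2 (at_nodes_head Q3).
Qed.

Hypothesis dotted_shortcut : forall e f g i j k,
  kind G e = Dotted -> joins G e i j -> kind G f = Dotted -> joins G f j k ->
  i != k -> kind G g = Arc -> endpoint G g j ->
  exists2 h, kind G h = Dotted & joins G h i k.

(* [z_open] without the spouse alternative, which is ruled out on a shortest
   walk. *)
Definition p_open oe k oo : Prop :=
  if collider_at oe k oo then An G C k
  else k \notin C \/ dotted_at oe oo /\ pa G k :\: C <> set0.

(** A dotted edge enters [z_open] only through its kind, so one may replace another. *)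
Lemma dotted_z_open d e k oo : kind G d = Dotted -> kind G e = Dotted ->
  z_open (Some d) k oo -> z_open (Some e) k oo.
Proof.
move=> kd ke; rewrite /z_open.
have -> : collider_at (Some e) k oo = collider_at (Some d) k oo.
  case: oo => //= f.
  rewrite /collider_edges (dotted_arrowhead k kd) (dotted_arrowhead k ke).
  by rewrite kd ke.
suff -> : dotted_at (Some e) oo = dotted_at (Some d) oo by [].
by case: oo => //= f; rewrite kd ke.
Qed.

(** Where a node with spouses lies between two dotted lines, these are replaced by the dotted line
    joining its neighbours, which still see a dotted line. *)
Lemma shorten_dotted x p : walk G x p -> at_nodes z_open None x p ->
    uniq (nodes x p) ->
  at_nodes p_open None x p \/
  exists q, [/\ size q < size p, walk G x q, final x q = final x p
              & at_nodes z_open None x q].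
Proof.
move=> wp Qp up.
pose B oe k oo := dotted_at oe oo /\ sp G k <> set0.
case: (@at_nodes_dichotomy z_open p_open B None x p) => // [oe k oo||].
- rewrite /z_open /p_open /B; case: ifP => [|_]; first by left.
  by case=> [|[? []]]; tauto.
- by left.
case=> p1 [p2 [eqp [dd /eqP/set0Pn [s sk]]]]; right; move: sk.
rewrite inE => /existsP [g /andP [/eqP kg /joins_endpointr gk]].
move: eqp dd gk.
case/lastP: p1 => // p1 [e k]; case: p2 => [|[f l] p2]; rewrite prev_rcons //.
rewrite -cats1 -catA final_cat /= => eqp /andP [/eqP ke /eqP kf] gk.
move: wp; rewrite eqp walk_cat /= => /and4P [wp1 ehk fkl wp2].
(* On a path the two neighbours differ, as [dotted_shortcut] demands. *)
have hl : final x p1 != l.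
  move: up; rewrite eqp => /uniq_nodes_cat /=.
  by rewrite !inE; case: (_ == l); rewrite ?orbT.
have [h kh hh] := dotted_shortcut ke ehk kf fkl hl kg gk.
exists (p1 ++ (h, l) :: p2); split=> //.
- by rewrite !size_cat ltn_add2l.
- by rewrite walk_cat wp1 /= hh.
- by rewrite !final_cat.
move: Qp; rewrite eqp => /at_nodes_cat [Q1 /= [Qh [Qk Q2]]].
apply/at_nodes_cat; split=> //; split.
  by apply/z_openC/(dotted_z_open ke kh)/z_openC.
apply: at_nodes_rehead (Q2) _.
exact: dotted_z_open kf kh (at_nodes_head Q2).
Qed.

Lemma shortest_z_walk x p : walk G x p -> at_nodes z_open None x p ->
  exists q, [/\ is_path G x q, final x q = final x p,
              at_nodes z_open None x q & at_nodes p_open None x q].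
Proof.
have [n] := ubnP (size p); elim: n p => // n IH p /ltnSE le_p wp Qp.
have shorter q : size q < size p -> walk G x q -> final x q = final x p ->
    at_nodes z_open None x q ->
  exists q, [/\ is_path G x q, final x q = final x p,
              at_nodes z_open None x q & at_nodes p_open None x q].
  by move=> lt_q wq <- Qq; apply: IH => //; apply: leq_trans le_p.
have [up|up] := boolP (uniq (nodes x p)); last first.
  by have [q []] := shorten_repeat wp Qp up; apply: shorter.
case: (shorten_dotted wp Qp up) => [Pp|[q []]]; last exact: shorter.
by exists p; rewrite /is_path wp up.
Qed.

End Excision.

(** * Inserting round trips *)

(** The trip follows arrows to the first node of [C], a collider where it turns, and returns the
    same way. All other occurrences are outside [C] and adjacent to a tail. Leaving and returning by
    the same arrow [g] makes [x] a non-collider at both of its occurrences. *)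
Lemma round_trip x : An G C x -> x \notin C ->
  exists g q, [/\ tail_at g x, walk G x q, final x q = x,
    forall oe, prev oe q = Some g & forall oe, at_starts node_open oe x q].
Proof.
case=> c cC [p [dp fp]].
elim: p x dp fp => [|[g y] p IH] x.
  by rewrite /final /= => _ ->; rewrite cC.
rewrite directed_walk_cons => /and3P [gxy gx dp] fp xC.
have Qx oe : node_open oe x (Some g).
  by rewrite /node_open (negbTE xC) collider_atC tail_collider_at.
have [yC|yC] := boolP (y \in C).
  exists g, [:: (g, y); (g, x)]; rewrite /= gxy joins_sym gxy.
  split=> // oe; split=> //; split=> //.
  have gy := tail_head gxy gx.
  by rewrite /node_open yC /= /collider_edges gy.
have [h [q [hy wq fq lq Qq]]] := IH _ dp fp yC.
exists g, ((g, y) :: rcons q (g, x)); split=> //.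
- by rewrite /= gxy -cats1 walk_cat wq fq /= joins_sym gxy.
- by rewrite -rcons_cons -cats1 final_cat.
- by move=> oe; rewrite -rcons_cons prev_rcons.
move=> oe; split=> //; rewrite -cats1; apply/at_starts_cat; split=> //.
by split=> //; rewrite lq fq /node_open (negbTE yC) tail_collider_at.
Qed.

Lemma insert_round_trips oe x p : walk G x p -> at_nodes p_open oe x p ->
  exists q, [/\ walk G x q, final x q = final x p & at_nodes node_open oe x q].
Proof.
elim: p oe x => [|[e y] p IH] oe x /=.
  move=> _ Qx; exists [::]; split=> //=; move: Qx; rewrite /p_open /node_open.
  by case: oe => [e|] /= [/negbTE|[]].
case/andP=> exy wp [Qx /(IH _ _ wp) [q [wq fq Qq]]].
(* Either the step is kept as it is, or a closed walk [q'] at [x] is inserted before it. *)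
have direct : node_open oe x (Some e) ->
    exists q, [/\ walk G x q, final x q = final x ((e, y) :: p)
                & at_nodes node_open oe x q].
  move=> Ox; exists ((e, y) :: q); rewrite /= exy wq.
  by split=> //; apply: fq.
have detour q' : walk G x q' -> final x q' = x ->
    at_starts node_open oe x q' -> node_open (prev oe q') x (Some e) ->
    exists q, [/\ walk G x q, final x q = final x ((e, y) :: p)
                & at_nodes node_open oe x q].
  move=> wq' fq' Oq' Ox; exists (q' ++ (e, y) :: q).
  rewrite walk_cat wq' final_cat fq' /= exy wq; split=> //.
  by apply/at_nodes_cat; rewrite fq'.
move: Qx; rewrite /p_open; case: ifP => [cx Ax|ncx].
  have [xC|xC] := boolP (x \in C).
    by apply: direct; rewrite /node_open xC cx.
  have [g [q' [gx wq' fq' lq' Oq']]] := round_trip Ax xC.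
  apply: (detour q') => //.
  by rewrite lq' /node_open (negbTE xC) tail_collider_at.
case=> [xC|]; first by apply: direct; rewrite /node_open ncx (negbTE xC).
case=> dd /eqP/set0Pn [z]; rewrite !inE => /andP [zC /existsP [g]].
case/and3P=> /eqP kg /eqP sg /eqP tg.
have [xC|xC] := boolP (x \in C); last first.
  by apply: direct; rewrite /node_open ncx (negbTE xC).
have gx : arrowhead_at G g x by rewrite /arrowhead_at /arrow_to kg tg !eqxx.
have gz : tail_at g z by rewrite /tail_at kg sg !eqxx.
have gzx : joins G g z x by rewrite /joins sg tg !eqxx.
case: oe dd ncx direct detour => [d|] //= /andP [/eqP kd /eqP ke] ncx _ detour.
(* Between a dotted line and the head of [g], [x] is a collider in [C] both before and after the
   visit to [z], which is a non-collider outside [C]. *)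
apply: (detour [:: (g, z); (g, x)]) => /=.
- by rewrite joins_sym gzx.
- by [].
- split; first by rewrite /node_open xC /= /collider_edges gx kd !orbT.
  by split=> //; rewrite /node_open tail_collider_at // (negbTE zC).
- by rewrite /node_open xC /= /collider_edges gx ke orbT.
Qed.

End Separation.

(** * Comparison of the separation criteria *)

Lemma separated_z :
    no_arrowhead_at_line G -> (forall x, ~ dreach x x) ->
    (forall e f g i j k,
       kind G e = Dotted -> joins G e i j ->
       kind G f = Dotted -> joins G f j k -> i != k ->
       kind G g = Arc -> endpoint G g j ->
       exists2 h, kind G h = Dotted & joins G h i k) ->
  forall A B C : {set V}, separated G A B C <-> z_separated G A B C.
Proof.
move=> hl acyc short A B C.
suff cz : (exists x p, joins_sets G A B x p /\ connecting G C x p) <->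
    exists x p, [/\ joins_sets G A B x p, is_path G x p & z_connecting G C x p].
  by split=> n /cz.
split=> [[x [p [[xA pB wp]]]]|[x [p [[xA pB wp] _]]]].
  move/(connecting_at_nodes hl C wp)/node_open_z => Qp.
  have [q [pq fq Qq _]] := shortest_z_walk hl acyc short wp Qp.
  exists x, q; split=> //; last exact/z_connectingP.
  by split=> //; [rewrite fq | case/andP: pq].
move/z_connectingP => Qp.
(* The given path is shortened as well, to get rid of the spouse alternative before inserting round
   trips. *)
have [q [/andP [wq _] fq _ Pq]] := shortest_z_walk hl acyc short wp Qp.
have [r [wr fr Or]] := insert_round_trips wq Pq.
exists x, r; split; first by split=> //; rewrite fr fq.
exact/connecting_at_nodes.
Qed.

(** Without dotted lines the exceptional clause of z-connection never applies. *)
Lemma z_separated_m (A B C : {set V}) :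
  no_kind G Dotted -> z_separated G A B C <-> m_separated G A B C.
Proof.
move=> nd.
suff zm x p : z_connecting G C x p <-> m_connecting G C x p.
  by split=> n [x [p [j pp /zm c]]]; apply: n; exists x, p.
have bd (p1 p2 : steps) : between_dotted G p1 p2 = false.
  rewrite /between_dotted; case: (last_edge p1) (first_edge p2) => [e|] [f|] //.
  by case: eqP => // /nd.
split=> c p1 p2 /c /=; case: ifP => // _; first by rewrite bd; case=> // -[].
by left.
Qed.

Lemma separated_c (A B C : {set V}) :
  no_kind G Dotted -> separated G A B C <-> c_separated G A B C.
Proof.
move=> nd.
have nd' e : (kind G e == Dotted) = false by apply/eqP/nd.
have cs x (p1 s p2 : steps) :
    collider_section G x p1 s p2 = arrowheads_meet G x p1 s p2.
  rewrite /collider_section /arrowheads_meet /collider_edges.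
  case: (last_edge p1) (first_edge p2) => [e|] [f|] //.
  by rewrite !nd' andbF /= !orbF.
by split=> n [x [p [j c]]]; apply: n; exists x, p; split=> // p1 s p2 /c ->.
Qed.

Lemma separated_route (A B C : {set V}) :
  no_kind G Line -> no_kind G Arc ->
  separated G A B C <-> route_separated G A B C.
Proof.
move=> nl na.
have hl : no_arrowhead_at_line G by move=> e f k _ /nl.
have ah e k : arrowhead_at G e k = arrow_to G e k.
  by rewrite /arrowhead_at; case: eqP => [/na|]; rewrite //= orbF.
have nr x p : at_nodes (node_open C) None x p <-> route_connecting G C x p.
  split=> [/at_nodesP|] c; [|apply/at_nodesP]; move=> p1 p2 /c;
  rewrite /node_open => ->;
  rewrite /route_collider /collider_at;
  case: (last_edge p1) (first_edge p2) => [e|] [f|] //;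
  by rewrite /collider_edges !ah.
split=> n [x [p [j c]]]; apply: n; exists x, p; split=> //; case: j => _ _ wp.
  by apply/connecting_at_nodes => //; apply/nr.
by apply/nr/connecting_at_nodes.
Qed.

End Walks.

(** * Subclasses of graphs *)

Section ChainGraphs.
Variables (V E : finType) (G : mixed_graph V E).

Lemma chain_component_joins e x y :
  joins G e x y -> kind G e != Arrow ->
  chain_component G x = chain_component G y.
Proof.
move=> exy ke.
have sym : connect_sym (linked_without_arrow G).
  apply: sym_connect_sym => i j.
  by apply/existsP/existsP=> -[f]; exists f; rewrite joins_sym.
apply/setP => z; rewrite !inE; apply: same_connect sym _ _ _ z.
by apply: connect1; apply/existsP; exists e; rewrite ke.
Qed.

(* A forward walk of G contracts to a directed walk between components. *)
Lemma chain_graph_acyclic : chain_graph G ->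
  ~ exists x p, [/\ closed_walk G x p, has (of_kind G Arrow) p
                  & all (arrow_forward G) p].
Proof.
case=> _ [H [[oneH acyc] Hst]] [x [p [/andP [wp /eqP fp] ha fw]]].
pose comp := chain_component G.
(* Steps that are not arrows stay in one component, so only arrows contribute to the contracted
   walk. *)
suff gen y : walk G y p -> if has (of_kind G Arrow) p
    then dreach H (comp y) (comp (final y p)) else comp y = comp (final y p).
  by have := gen x wp; rewrite ha fp; apply: acyclic_dreach acyc _.
elim: p fw y {wp fp ha} => [|[e z] p IH] //= /andP [fwe /IH {}IH] y.
case/andP=> eyz /IH {IH}; rewrite -[final y _]/(final z p).
have [ke|ke] /= := boolP (of_kind G Arrow (e, z)); last first.
  by rewrite /comp (chain_component_joins eyz ke).
have [tz sy] : tgt G e = z /\ src G e = y.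
  move: fwe; rewrite /arrow_forward ke => /eqP tz; split=> //.
  case/orP: eyz => /andP [/eqP s1 /eqP s2] //.
  by have := no_loop G e; rewrite s1 tz eqxx.
pose a : arrow_of G := exist _ e ke.
have [sa ta] := Hst a; rewrite /= sy tz in sa ta.
have ja : joins H a (comp y) (comp z) by rewrite /joins sa ta !eqxx.
have la : tail_at H a (comp y).
  by rewrite /tail_at sa eqxx andbT; have := oneH a; rewrite inE.
case: ifP => _ => [|<-]; first exact: dreach_cons ja la.
exact: dreach1 ja la.
Qed.

Lemma chain_graph_cmg :
  chain_graph G -> no_kind G Dotted -> chain_mixed_graph G.
Proof.
move=> /chain_graph_acyclic acyc nd; split=> // -[x [p [/and3P [cp _ _]]]].
by case/and4P=> _ ha _ fw; apply: acyc; exists x, p.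
Qed.

(** The two conditions involving arcs hold vacuously; the one on closed walks is
    [chain_graph_acyclic]. *)
Lemma chain_graph_mamp :
  chain_graph G -> only_kinds G [:: Dotted; Arrow] -> marginal_AMP_graph G.
Proof.
move=> /chain_graph_acyclic acyc ok.
have na : no_kind G Arc by move=> e ke; have := ok e; rewrite ke.
split=> //.
- by move=> e ke; have := ok e; rewrite ke.
- case=> x [p [_ c1 _]]; have : has (of_kind G Arc) p by rewrite has_count c1.
  by case/hasP=> st _ /eqP /na.
- by move=> e f g i j k _ _ _ _ _ /na.
Qed.

Lemma arrowless_cmg :
  no_kind G Arrow -> no_kind G Dotted -> chain_mixed_graph G.
Proof.
move=> nA nd; split=> // -[x [p [_ /and4P [_ /hasP [st _ /eqP]]]]].
by move/nA.
Qed.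

Lemma dag_summary : DAG G -> summary_graph G.
Proof.
case=> ok acyc; split; last by move=> e f k _ kf; have := ok f; rewrite kf.
split=> [e ke|[x [p [cp /and4P [wp _ _ fw]]]]].
  by have := ok e; rewrite ke.
apply: acyc; exists x, p; rewrite /directed_walk wp; split=> //.
apply/allP => st stp; rewrite (allP fw _ stp) andbT.
by have := ok st.1; rewrite inE.
Qed.

End ChainGraphs.

Theorem theorem2 (V E : finType) (G : mixed_graph V E) :
  [/\
   (* (1) *)
   [/\ (ancestral_graph G \/ ADMG G \/ bidirected_chain_graph G \/
        regression_graph G \/ undirected_graph G \/ bidirected_graph G \/
        DAG G -> summary_graph G)
     & (summary_graph G ->
        forall A B C : {set V},
          [disjoint A & B] -> [disjoint A & C] -> [disjoint B & C] ->
          (separated G A B C <-> m_separated G A B C))],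
   (* (2) *)
   [/\ (anterial_graph G \/ undirected_chain_graph G -> chain_mixed_graph G)
     & (chain_mixed_graph G ->
        forall A B C : {set V},
          [disjoint A & B] -> [disjoint A & C] -> [disjoint B & C] ->
          (separated G A B C <-> c_separated G A B C))],
   (* (3) *)
   [/\ (dotted_line_chain_graph G \/ dotted_line_graph G ->
        marginal_AMP_graph G)
     & (marginal_AMP_graph G ->
        forall A B C : {set V},
          [disjoint A & B] -> [disjoint A & C] -> [disjoint B & C] ->
          (separated G A B C <-> z_separated G A B C))]
   & (* (4) *)
     (alternative_ADMG G ->
      forall A B C : {set V},
        [disjoint A & B] -> [disjoint A & C] -> [disjoint B & C] ->
        (separated G A B C <-> route_separated G A B C))].
Proof.
have absent ts t : only_kinds G ts -> t \notin ts -> no_kind G t.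
  by move=> ok tN e ke; have := ok e; rewrite ke (negbTE tN).
have lineless : no_kind G Line -> no_arrowhead_at_line G.
  by move=> nl e f k _ /nl.
split.
- split.
    case=> [[] //|[[] //|[[cg ok]|[[cg ok hl]|[ok|[ok|/dag_summary //]]]]]].
    + by split; [apply: chain_graph_cmg => // | apply: lineless];
        exact: absent ok _.
    + by split=> //; apply: chain_graph_cmg => //; exact: absent ok _.
    + split; first by apply: arrowless_cmg; exact: absent ok _.
      move=> e f k; have := ok e; rewrite inE => /eqP ke.
      by rewrite line_arrowhead.
    + by split; [apply: arrowless_cmg | apply: lineless]; exact: absent ok _.
  case=> cmg hl A B C _ _ _; have [nd _] := cmg.
  (* m-separation is reached through z-separation; the shortcut condition is vacuous without dotted
     lines. *)
  apply: iff_trans (z_separated_m A B C nd); apply: separated_z => //.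
    by move=> x; apply: summary_dreach.
  by move=> e f g i j k /nd.
- split; last by case=> nd _ A B C _ _ _; apply: separated_c.
  case=> [[] //|[cg ok]].
  by apply: chain_graph_cmg => //; exact: absent ok _.
- split=> [[[cg ok]|ok]|[nl fwd _ short] A B C _ _ _].
  + exact: chain_graph_mamp.
  + have nA : no_kind G Arrow by exact: absent ok _.
    have na : no_kind G Arc by exact: absent ok _.
    split; first exact: absent ok _.
    * by case=> x [p [_ /hasP [st _ /eqP /nA]]].
    * case=> x [p [_ c1 _]].
      have : has (of_kind G Arc) p by rewrite has_count c1.
      by case/hasP=> st _ /eqP /na.
    * by move=> e f g i j k _ _ _ _ _ /na.
  + apply: separated_z short A B C; first exact: lineless.
    by move=> x; apply: forward_closed_dreach.
(* The ADMG [H] has no lines, and its arcs become dotted in [G], so [G] has neither lines nor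
   arcs. *)
- case=> H [[_ nl] GH] A B C _ _ _; apply: separated_route => e.
    have [_ _ ->] := GH e; case: eqP => // _; exact: nl.
  by have [_ _ ->] := GH e; case: eqP.
Qed.
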